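(* Let an instance of the Penalized Knapsack Problem be given by $n$ items with non-negative integer profits $p_j$, weights $w_j$ and penalties $\pi_j$ ($j=1,\dots,n$) and a non-negative integer capacity $c$. For a real parameter $\Pi\in[0,\max_j \pi_j]$ let $$z^{LP}(\Pi)=\max\Big\{\sum_{j=1}^n p_jx_j-\Pi \;:\; \sum_{j=1}^n w_jx_j\le c,\; 0\le x_j\le \min\{1,\Pi/\pi_j\}\ (j=1,\dots,n)\Big\},$$ where the bound $\min\{1,\Pi/\pi_j\}$ is read as $1$ when $\pi_j=0$. Then $z^{LP}(\Pi)$ is a piecewise-linear concave function of $\Pi$ consisting of at most $2n$ linear segments.
   Context: The Penalized Knapsack Problem (PKP): choose $x\in\{0,1\}^n$ with $\sum_j w_jx_j\le c$ maximizing $\sum_j p_jx_j-\max\{\pi_j: x_j=1\}$ (the max over the empty set being $0$); equivalently maximize $\sum_j p_jx_j-\Pi$ subject to $\sum_j w_jx_j\le c$, $\pi_jx_j\le \Pi$ for all $j$, $x_j\in\{0,1\}$, $\Pi\in\mathbb{R}$. The function $z^{LP}(\Pi)$ is the optimal value of the linear relaxation ($x_j\in[0,1]$) of this formulation when the penalty variable is fixed to $\Pi$. *)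

(* Defs.v *)
From HB Require Import structures.
From mathcomp Require Import all_boot all_order all_algebra.
From mathcomp Require Import classical_sets reals convex.

Set Implicit Arguments.
Unset Strict Implicit.
Unset Printing Implicit Defensive.

Import Order.TTheory GRing.Theory Num.Theory.

Local Open Scope classical_set_scope.
Local Open Scope ring_scope.

Record pkp (n : nat) := PKP {
  profit : 'I_n -> nat;
  weight : 'I_n -> nat;
  penalty : 'I_n -> nat;
  capacity : nat }.

(* For n = 0 the maximum is 0. *)
Definition max_penalty (n : nat) (I : pkp n) : nat :=
  \max_(j < n) penalty I j.

(* The case split is needed: in MathComp, P / 0 = 0. *)
Definition var_bound (R : realType) (n : nat) (I : pkp n) (P : R) (j : 'I_n)
    : R :=
  if penalty I j == 0%N then 1 else Num.min 1 (P / (penalty I j)%:R).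

Definition lp_feasible (R : realType) (n : nat) (I : pkp n) (P : R)
    : set 'rV[R]_n :=
  [set x | \sum_(j < n) (weight I j)%:R * x 0 j <= (capacity I)%:R /\
           forall j : 'I_n, 0 <= x 0 j <= var_bound I P j].

Definition lp_objective (R : realType) (n : nat) (I : pkp n) (P : R)
    (x : 'rV[R]_n) : R :=
  \sum_(j < n) (profit I j)%:R * x 0 j - P.

Definition zLP (R : realType) (n : nat) (I : pkp n) (P : R) : R :=
  sup (lp_objective I P @` lp_feasible I P).

Definition is_max (R : realType) (A : set R) (m : R) : Prop :=
  A m /\ ubound A m.

Definition concave_on (R : realType) (D : set R) (f : R -> R) : Prop :=
  @convex_function R R^o D (fun x => - f x).

Definition affine_on (R : realType) (D : set R) (f : R -> R) : Prop :=
  exists a b : R, forall x, D x -> f x = a * x + b.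

(* Consecutive closed pieces share their endpoints, so f is continuous on
   [a, b].  For a = b the only possible number of segments is k = 0. *)
Definition piecewise_linear_on (R : realType) (a b : R) (m : nat) (f : R -> R)
    : Prop :=
  exists (k : nat) (t : nat -> R),
    [/\ (k <= m)%N, t 0%N = a, t k = b &
        forall i : nat, (i < k)%N ->
          t i < t i.+1 /\ affine_on `[t i, t i.+1] f].

(* Main.v *)
(** By LP duality, z(P) is the minimum over multipliers l >= 0 of the
    Lagrangian bound l c + sum_j u_j(P) max(0, p_j - l w_j) - P, where u_j is
    the variable bound, and the minimum is attained at some l among 0 and the
    n ratios p_j / w_j (greedy fractional filling).  Each bound is concave in
    P and affine between consecutive penalties.  For l <= m the difference of
    the bounds at m and at l is nonincreasing in P, so the optimal multiplier
    can only grow with P and changes at most n times.  These n thresholds and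
    the n penalties, the largest of which is the right endpoint, are all the
    breakpoints, which leaves at most 2n segments. *)
Require Import Defs.
From mathcomp Require Import all_boot all_order all_algebra.
From mathcomp Require Import classical_sets reals convex.
From mathcomp Require Import boolp interval_inference ring lra unstable.

Import Order.TTheory GRing.Theory Num.Theory.
Local Open Scope classical_set_scope.
Local Open Scope ring_scope.

(** * Affine functions, and piecewise linearity from a list of breakpoints *)

Lemma affine_on_ext (R : realType) (D : set R) (f g : R -> R) :
  (forall x, D x -> f x = g x) -> affine_on D g -> affine_on D f.
Proof. by move=> fg [a [b H]]; exists a, b => x Dx; rewrite fg// H. Qed.

Lemma affine_on_cst (R : realType) (D : set R) (k : R) :
  affine_on D (fun=> k).
Proof. by exists 0, k => x _; rewrite mul0r add0r. Qed.

Lemma affine_on_scale (R : realType) (D : set R) (k : R) :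
  affine_on D (fun x => x * k).
Proof. by exists k, 0 => x _; rewrite addr0 mulrC. Qed.

Lemma affine_onD (R : realType) (D : set R) (f g : R -> R) :
  affine_on D f -> affine_on D g -> affine_on D (fun x => f x + g x).
Proof.
move=> [a [b fE]] [c [d gE]]; exists (a + c), (b + d) => x Dx.
by rewrite fE// gE//; ring.
Qed.

Lemma affine_onMr (R : realType) (D : set R) (k : R) (f : R -> R) :
  affine_on D f -> affine_on D (fun x => f x * k).
Proof.
by move=> [a [b fE]]; exists (a * k), (b * k) => x Dx; rewrite fE//; ring.
Qed.

Lemma affine_on_sum (R : realType) (D : set R) (J : Type) (r : seq J)
    (f : J -> R -> R) :
  (forall j, affine_on D (f j)) -> affine_on D (fun x => \sum_(j <- r) f j x).
Proof.
move=> fP; elim: r => [|j r IH].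
  by apply: affine_on_ext (affine_on_cst _ _ 0) => x _; rewrite big_nil.
by apply: affine_on_ext (affine_onD _ _ _ _ (fP j) IH) => x _; rewrite big_cons.
Qed.

(** Carries an inequality between affine functions from the open interval, where the minimizer is
    known, to the endpoints. *)
Lemma affine_ge0_closure (R : realType) (x y : R) (h : R -> R) :
  x < y -> affine_on `[x, y] h -> (forall q, x < q < y -> 0 <= h q) ->
  forall q, x <= q <= y -> 0 <= h q.
Proof.
move=> xy [a [b hE]] h0 q qxy.
have {}hE z : x <= z <= y -> h z = a * z + b.
  by move=> zxy; apply: hE; rewrite /= in_itv.
rewrite hE// leNgt; apply/negP => hq.
pose m := (x + y) / 2.
have mxy : x < m < y by rewrite /m; apply/andP; split; lra.
have hm := h0 m mxy; rewrite hE in hm; last lra.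
(* Halfway between q and the zero of h on the segment from q to m, h is still negative. *)
have amq : 0 < a * (m - q) by rewrite mulrBr; lra.
pose s := - (a * q + b) / (a * (m - q)) / 2.
have s0 : 0 < s by rewrite /s !divr_gt0//; lra.
have s1 : s < 1.
  rewrite /s mulrAC ltr_pdivrMr//; rewrite mulrBr; lra.
have sE : s * (a * (m - q)) = - (a * q + b) / 2.
  by rewrite /s mulrAC divfK// gt_eqF.
have zxy : x < q + s * (m - q) < y by apply/andP; split; nra.
have := h0 _ zxy; rewrite hE; last lra.
have -> : a * (q + s * (m - q)) + b = a * q + b + s * (a * (m - q)) by ring.
rewrite sE; lra.
Qed.

(** Cutting at [a] and at the distinct points of [s] in (a, b] gives at most [size s] pieces with no
    point of [s] inside; [b \in s] makes the last piece end at [b]. *)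
Lemma piecewise_linear_on_breakpoints (R : realType) (a b : R) (s : seq R)
    (f : R -> R) :
  a < b -> b \in s ->
  (forall x y, a <= x -> x < y -> y <= b ->
     (forall t, t \in s -> ~~ (x < t < y)) -> affine_on `[x, y] f) ->
  piecewise_linear_on a b (size s) f.
Proof.
move=> ab bs fP.
pose s1 := sort <=%R [seq t <- undup s | a < t <= b].
have s1E t : (t \in s1) = (a < t <= b) && (t \in s).
  by rewrite mem_sort mem_filter mem_undup.
pose r := a :: s1.
have sr : sorted <%R r.
  rewrite /r /= lt_path_sortedE sort_lt_sorted filter_uniq ?undup_uniq// andbT.
  by apply/allP => t; rewrite s1E => /andP[/andP[]].
have nth_lt i j : (i < size r)%N -> (j < size r)%N ->
    (nth b r i < nth b r j) = (i < j)%N.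
  by move=> ir jr; rewrite (lt_sorted_ltn_nth b sr).
have nth_le i j : (i < size r)%N -> (j < size r)%N ->
    (nth b r i <= nth b r j) = (i <= j)%N.
  by move=> ir jr; rewrite (lt_sorted_leq_nth b sr).
have rab i : (i < size r)%N -> a <= nth b r i <= b.
  move=> ir; have : nth b r i \in r by apply: mem_nth.
  rewrite in_cons s1E => /orP[/eqP->|/andP[/andP[/ltW-> ->]]//].
  by rewrite lexx ltW.
have br : b \in s1 by rewrite s1E ab lexx.
exists (size s1), (nth b r); split => //.
- rewrite size_sort size_filter (leq_trans (count_size _ _))//.
  exact: size_undup.
- apply/eqP; rewrite eq_le; apply/andP; split.
    by have /andP[] := rab (size s1) (ltnSn _).
  have br' : b \in r by rewrite in_cons br orbT.
  rewrite -{1}(nth_index b br') nth_le//; last by rewrite index_mem.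
  by rewrite -ltnS -[X in (_ < X)%N]/(size r) index_mem.
move=> i ik.
have ir : (i < size r)%N by apply: ltnW.
have ir1 : (i.+1 < size r)%N by [].
split; first by rewrite nth_lt.
apply: fP.
- by have /andP[] := rab _ ir.
- by rewrite nth_lt.
- by have /andP[] := rab _ ir1.
(* Such a [t] would be an entry of [r] with index strictly between [i] and [i.+1]. *)
move=> t ts; apply/negP => /andP[it ti].
have tr : t \in r.
  rewrite in_cons s1E ts andbT.
  have /andP[ai _] := rab _ ir; have /andP[_ bi] := rab _ ir1.
  by rewrite (le_lt_trans ai it) (le_trans (ltW ti) bi) orbT.
move: it ti; rewrite -(nth_index b tr) !nth_lt ?index_mem// => h1 h2.
by move: (leq_trans h1 h2); rewrite ltnn.
Qed.

(** * Lower envelopes of finite families with single crossing *)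

Section LowerEnvelope.
Context (R : realType) (T : finType) (key : T -> R) (g : R -> R -> R) (a b : R).

Definition argmin (o : T) (x : R) : Prop :=
  forall o', g (key o) x <= g (key o') x.

(** Minimizers may tie; asking for just one of at least this key gives a condition that persists as
    [x] grows. *)
Definition reaches (o : T) (x : R) : Prop :=
  exists2 o', key o <= key o' & argmin o' x.

(** On the empty set [inf] is the default 0, which is harmless: [o] is then reached nowhere on
    [a, b]. *)
Definition threshold (o : T) : R :=
  inf [set x | a <= x <= b /\ reaches o x].

Hypothesis g_single_crossing : forall l m x y, l <= m ->
  a <= x -> x <= y -> y <= b -> g m y - g l y <= g m x - g l x.

Lemma argmin_exists (o0 : T) (x : R) : exists o, argmin o x.
Proof.
case: (@arg_minP _ R T o0 xpredT (fun o => g (key o) x)) => // o _ oP.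
by exists o => o'; apply: oP.
Qed.

(** If a minimizer at [y] has a smaller key than [o], the minimizer [m] at [x] loses nothing against
    it from [x] to [y], so [m] still minimizes at [y]. *)
Lemma reaches_le (o : T) (x y : R) :
  a <= x -> x <= y -> y <= b -> reaches o x -> reaches o y.
Proof.
move=> ax xy yb [m om mP]; have [m' m'P] := argmin_exists o y.
have [om'|m'o] := leP (key o) (key m'); first by exists m'.
exists m => // o'; apply: le_trans (m'P o').
have := g_single_crossing _ _ _ _ (ltW (lt_le_trans m'o om)) ax xy yb.
have := mP m'; lra.
Qed.

Lemma reaches_between (o : T) (x y p q : R) :
  a <= x -> y <= b -> ~~ (x < threshold o < y) -> x < p < y -> x < q < y ->
  reaches o p -> reaches o q.
Proof.
move=> ax yb tP pxy qxy op.
have [pq|qp] := leP p q; first by apply: reaches_le op => //; lra.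
have Sp : [set x | a <= x <= b /\ reaches o x] p by split => //; lra.
have tp : threshold o <= p.
  by apply: ge_inf => //; exists a => z [/andP[]].
(* Being at most [p < y] and outside (x, y), the threshold lies below [q], hence so does some point
   where [o] is reached. *)
have tx : threshold o <= x by move: tP; rewrite negb_and -!leNgt => /orP[]; lra.
have [||e [eab oe] eq] := @inf_lt R [set x | a <= x <= b /\ reaches o x] q.
- by exists p.
- by rewrite -/(threshold o); lra.
by apply: reaches_le oe; lra.
Qed.

(** Take the largest key reached at the midpoint. No option starts being reached inside (x, y), so
    this key is minimal throughout. The least key, that of [o0], is reached everywhere and needs no
    threshold, which saves one breakpoint. *)
Lemma argmin_constant (o0 : T) (x y : R) :
  (forall o, key o0 <= key o) -> a <= x -> x < y -> y <= b ->
  (forall o, o != o0 -> ~~ (x < threshold o < y)) ->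
  exists o, forall q, x < q < y -> argmin o q.
Proof.
move=> o0min ax xy yb tP.
have reach0 q : reaches o0 q.
  by have [o oP] := argmin_exists o0 q; exists o.
have reachC o p q : x < p < y -> x < q < y -> reaches o p -> reaches o q.
  have [-> //|oo0] := eqVneq o o0.
  by apply: reaches_between => //; apply: tP.
pose p := (x + y) / 2.
have pxy : x < p < y by rewrite /p; apply/andP; split; lra.
have [|o /asboolP op omax] := @arg_maxP _ R T o0 (fun o => `[<reaches o p>]) key.
  by apply/asboolP.
exists o => q qxy; have [m om mP] := reachC o p q pxy qxy op.
have mo : key m <= key o.
  by apply: omax; apply/asboolP; apply: (reachC m q p) => //; exists m.
by rewrite /argmin (_ : key o = key m)//; apply/eqP; rewrite eq_le om mo.
Qed.

Lemma envelope_affine (o0 : T) (f : R -> R) (x y : R) :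
  (forall o, key o0 <= key o) -> a <= x -> x < y -> y <= b ->
  (forall o, o != o0 -> ~~ (x < threshold o < y)) ->
  (forall o, affine_on `[x, y] (g (key o))) ->
  (forall q, a <= q <= b -> forall o, argmin o q -> f q = g (key o) q) ->
  affine_on `[x, y] f.
Proof.
move=> o0min ax xy yb tP gaff fE.
have [o oP] := argmin_constant o0 x y o0min ax xy yb tP.
apply: affine_on_ext (gaff o) => q; rewrite /= in_itv/= => qxy.
apply: fE; first lra.
move=> o'; rewrite -subr_ge0.
apply: (affine_ge0_closure _ x y (fun q => g (key o') q - g (key o) q)) qxy => //.
  apply: affine_onD => //.
  by apply: affine_on_ext (affine_onMr _ _ (-1) _ (gaff o)) => z _; rewrite mulrN1.
by move=> z zxy; rewrite subr_ge0; apply: oP.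
Qed.

End LowerEnvelope.

(** * Variable bounds and the Lagrangian dual *)

Section Duality.
Context (R : realType) (n : nat) (I : pkp n).
Local Notation u := (@var_bound R n I).
Local Notation w j := ((weight I j)%:R : R).
Local Notation p j := ((profit I j)%:R : R).
Local Notation c := ((capacity I)%:R : R).

Lemma var_bound_ge0 P j : 0 <= P -> 0 <= u P j.
Proof.
move=> P0; rewrite /var_bound; case: ifP => // _.
by rewrite le_min ler01 divr_ge0.
Qed.

Lemma var_bound_le P Q j : P <= Q -> u P j <= u Q j.
Proof.
move=> PQ; rewrite /var_bound; case: ifP => // _.
by rewrite le_min ge_min lexx /= ge_min ler_wpM2r ?invr_ge0// orbT.
Qed.

Lemma var_bound_concave P Q t j : 0 <= t <= 1 ->
  t * u P j + (1 - t) * u Q j <= u (t * P + (1 - t) * Q) j.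
Proof.
move=> t01; rewrite /var_bound; case: ifP => _; first lra.
set k := (penalty I j)%:R.
have mP : Num.min 1 (P / k) <= 1 by rewrite ge_min lexx.
have mQ : Num.min 1 (Q / k) <= 1 by rewrite ge_min lexx.
have mP' : Num.min 1 (P / k) <= P / k by rewrite ge_min lexx orbT.
have mQ' : Num.min 1 (Q / k) <= Q / k by rewrite ge_min lexx orbT.
rewrite le_min; apply/andP; split; first nra.
rewrite [leRHS]mulrDl -!mulrA; nra.
Qed.

(** The only kink is at the penalty, where the ratio reaches 1. *)
Lemma var_bound_affine x y j : x < y ->
  ~~ (x < (penalty I j)%:R < y) -> affine_on `[x, y] (u^~ j).
Proof.
move=> xy jP; have [k0|k0] := eqVneq (penalty I j) 0%N.
  by apply: affine_on_ext (affine_on_cst _ _ 1) => z _; rewrite /var_bound k0 eqxx.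
have k_gt0 : 0 < (penalty I j)%:R :> R by rewrite ltr0n lt0n.
move: jP; rewrite negb_and -!leNgt => /orP[kx|yk].
  apply: affine_on_ext (affine_on_cst _ _ 1) => z; rewrite /= in_itv/= => /andP[xz _].
  rewrite /var_bound (negbTE k0).
  by apply/min_idPl; rewrite ler_pdivlMr// mul1r (le_trans kx).
apply: affine_on_ext (affine_on_scale _ _ (penalty I j)%:R^-1) => z.
rewrite /= in_itv/= => /andP[_ zy]; rewrite /var_bound (negbTE k0).
by apply/min_idPr; rewrite ler_pdivrMr// mul1r (le_trans zy).
Qed.

(* The value of the Lagrangian relaxation of the capacity constraint. *)
Definition dual (l P : R) : R :=
  l * c + \sum_(j < n) u P j * Num.max 0 (p j - l * w j) - P.

(* [None] is the multiplier 0; items of weight 0 also give 0. *)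
Definition multiplier (o : option 'I_n) : R :=
  if o is Some j then p j / w j else 0.

Lemma multiplier_ge0 o : 0 <= multiplier o.
Proof. by case: o => //= j; rewrite divr_ge0. Qed.

Lemma dual_concave l P Q t : 0 <= t <= 1 ->
  t * dual l P + (1 - t) * dual l Q <= dual l (t * P + (1 - t) * Q).
Proof.
move=> t01; rewrite /dual.
have : t * (\sum_(j < n) u P j * Num.max 0 (p j - l * w j))
   + (1 - t) * (\sum_(j < n) u Q j * Num.max 0 (p j - l * w j))
   <= \sum_(j < n) u (t * P + (1 - t) * Q) j * Num.max 0 (p j - l * w j).
  rewrite !mulr_sumr -big_split; apply: ler_sum => j _ /=.
  rewrite !mulrA -mulrDl ler_wpM2r//; first by rewrite le_max lexx.
  exact: var_bound_concave.
by lra.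
Qed.

(** Termwise: a larger multiplier cannot raise the reduced profit max(0, p - l w), and a larger [P]
    cannot lower the bound, so the product of the two increments is nonpositive. *)
Lemma dual_single_crossing l m P Q : l <= m -> P <= Q ->
  dual m Q - dual l Q <= dual m P - dual l P.
Proof.
move=> lm PQ; rewrite /dual.
suff : \sum_(j < n) u Q j * Num.max 0 (p j - m * w j)
     + \sum_(j < n) u P j * Num.max 0 (p j - l * w j)
    <= \sum_(j < n) u P j * Num.max 0 (p j - m * w j)
     + \sum_(j < n) u Q j * Num.max 0 (p j - l * w j) by lra.
rewrite -!big_split; apply: ler_sum => j _ /=.
have : Num.max 0 (p j - m * w j) <= Num.max 0 (p j - l * w j).
  rewrite ge_max !le_max lexx /=; apply/orP; right.
  by rewrite lerB// ler_wpM2r.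
have := var_bound_le P Q j PQ; nra.
Qed.

Lemma dual_affine l x y : x < y ->
  (forall j, ~~ (x < (penalty I j)%:R < y)) -> affine_on `[x, y] (dual l).
Proof.
move=> xy H; apply: affine_onD; last first.
  by apply: affine_on_ext (affine_on_scale _ _ (-1)) => z _; rewrite mulrN1.
apply: affine_onD; first exact: affine_on_cst.
by apply: affine_on_sum => j; apply: affine_onMr; apply: var_bound_affine.
Qed.

Lemma weak_duality l P x : 0 <= l -> lp_feasible I P x ->
  lp_objective I P x <= dual l P.
Proof.
move=> l0 [xc xu]; rewrite /lp_objective /dual lerD2r.
(* As [l >= 0], the capacity may be replaced by the load of [x]; the rest is termwise. *)
apply: (@le_trans _ _ (l * (\sum_(j < n) w j * x 0 j) +
    \sum_(j < n) u P j * Num.max 0 (p j - l * w j))); last first.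
  by rewrite lerD2r ler_wpM2l.
rewrite mulr_sumr -big_split; apply: ler_sum => j _ /=.
have /andP[x0 xj] := xu j.
have : p j - l * w j <= Num.max 0 (p j - l * w j) by rewrite le_max lexx orbT.
have : 0 <= Num.max 0 (p j - l * w j) by rewrite le_max lexx.
nra.
Qed.

(** * Greedy filling and strong duality *)

Definition strict_load (l P : R) : R :=
  \sum_(j < n) (if l * w j < p j then w j * u P j else 0).

Definition tight_load (l P : R) : R :=
  \sum_(j < n) (if p j == l * w j then w j * u P j else 0).

(** All items with zero reduced profit share the same fraction [th], so no order among ties has to
    be chosen. *)
Definition greedy (l th P : R) : 'rV[R]_n :=
  \row_j (if l * w j < p j then u P j
          else if p j == l * w j then th * u P j else 0).

Lemma greedy_optimal l th P :
  0 <= P -> 0 <= th <= 1 -> strict_load l P + th * tight_load l P <= c ->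
  l * (strict_load l P + th * tight_load l P) = l * c ->
  lp_feasible I P (greedy l th P) /\
  lp_objective I P (greedy l th P) = dual l P.
Proof.
move=> P0 th01 loadc slack.
have loadE : \sum_(j < n) w j * greedy l th P 0 j
    = strict_load l P + th * tight_load l P.
  rewrite mulr_sumr -big_split; apply: eq_bigr => j _ /=; rewrite mxE.
  by case: (ltgtP (p j) (l * w j)) => _; ring.
split.
  split; first by rewrite loadE.
  move=> j; rewrite mxE; have := var_bound_ge0 P j P0.
  by case: ifP => _ => [?|]; [|case: ifP => _ ?]; apply/andP; split; nra.
rewrite /lp_objective /dual -slack -loadE mulr_sumr -big_split.
congr (_ - _); apply: eq_bigr => j _ /=; rewrite mxE.
case: (ltgtP (p j) (l * w j)) => h.
- by rewrite max_l; [ring | lra].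
- by rewrite max_r; [ring | lra].
- by rewrite h subrr maxxx; ring.
Qed.

(** Either multiplier 0 already fits, or the least multiplier whose strict load fits leaves room
    that its tied items can fill exactly. *)
Lemma strong_duality (P : R) : 0 <= P ->
  exists o x, lp_feasible I P x /\ lp_objective I P x = dual (multiplier o) P.
Proof.
move=> P0.
suff [o [th [th01 loadc slack]]] : exists o th, [/\ 0 <= th <= 1,
    strict_load (multiplier o) P + th * tight_load (multiplier o) P <= c &
    multiplier o * (strict_load (multiplier o) P + th * tight_load (multiplier o) P)
      = multiplier o * c].
  exists o, (greedy (multiplier o) th P); exact: greedy_optimal.
have [A0|A0] := leP (strict_load 0 P) c.
  by exists None, 0; rewrite /= !mul0r addr0; split => //; rewrite lexx ler01.
(* At the largest multiplier only items of weight 0 can be strictly profitable, so the strict load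
   is 0 and fits. *)
have [o1 _ o1max] := @arg_maxP _ R _ (None : option 'I_n) xpredT multiplier isT.
have o1c : strict_load (multiplier o1) P <= c.
  rewrite /strict_load big1// => j _; case: ifP => // h.
  have [->|w0] := eqVneq (weight I j) 0%N; first by rewrite mul0r.
  have := o1max (Some j) isT; rewrite /= ler_pdivrMr ?ltr0n ?lt0n// leNgt.
  by rewrite h.
have [o oc omin] := @arg_minP _ R _ o1
  (fun o => strict_load (multiplier o) P <= c) multiplier o1c.
have o_gt0 : 0 < multiplier o.
  rewrite lt_def multiplier_ge0 andbT; apply/eqP => oE.
  by move: oc; rewrite oE leNgt A0.
(* A next smaller multiplier exists because [None] gives 0; it overfills by minimality of [o]. *)
have [o' o'o o'max] := @arg_maxP _ R _ None
  (fun o' => multiplier o' < multiplier o) multiplier o_gt0.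
have o'c : c < strict_load (multiplier o') P.
  by rewrite ltNge; apply/negP => /omin /=; rewrite leNgt o'o.
(* No multiplier lies strictly between the two, so the items strictly
   profitable at [o'] are those profitable, possibly tightly, at [o]. *)
have cAB : c <= strict_load (multiplier o) P + tight_load (multiplier o) P.
  apply: le_trans (ltW o'c) _; rewrite -big_split; apply: ler_sum => j _ /=.
  have wu0 : 0 <= w j * u P j by rewrite mulr_ge0// var_bound_ge0.
  have [wE|w0] := eqVneq (weight I j) 0%N.
    by rewrite wE !mul0r !if_same addr0.
  have w_gt0 : 0 < w j by rewrite ltr0n lt0n.
  case: ifP => [h|_]; last by do 2 case: ifP => _; lra.
  have : ~~ (multiplier (Some j) < multiplier o).
    apply/negP => /o'max /=; rewrite ler_pdivrMr// leNgt; by rewrite h.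
  rewrite -leNgt /= ler_pdivlMr//.
  by case: ltgtP => // _ _; lra.
pose A := strict_load (multiplier o) P; pose B := tight_load (multiplier o) P.
have B0 : 0 <= B.
  apply: sumr_ge0 => j _; case: ifP => // _.
  by rewrite mulr_ge0// var_bound_ge0.
(* If [B = 0], the quotient is 0 by convention, and A <= c <= A + B forces c = A. *)
have thB : (c - A) / B * B = c - A.
  have [B0'|B0'] := eqVneq B 0; last by rewrite divfK.
  by move: cAB; rewrite -/A -/B B0' mulr0; rewrite -/A in oc; lra.
have th0 : 0 <= (c - A) / B by rewrite divr_ge0// subr_ge0.
exists o, ((c - A) / B); rewrite -/A -/B thB; split.
- rewrite th0 /=; have [->|B0'] := eqVneq B 0; first by rewrite invr0 mulr0.
  by rewrite ler_pdivrMr ?lt_def ?B0' ?B0// mul1r; move: cAB; rewrite -/A -/B; lra.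
- lra.
- by congr (_ * _); ring.
Qed.

(** * The LP value as the minimum of the dual bounds *)

Lemma zLP_optimal (P : R) : 0 <= P ->
  is_max (lp_objective I P @` lp_feasible I P) (zLP I P).
Proof.
move=> P0; have [o [x [xf xE]]] := strong_duality P P0.
have xub : ubound (lp_objective I P @` lp_feasible I P) (lp_objective I P x).
  move=> _ [y yf <-]; rewrite xE; apply: weak_duality => //.
  exact: multiplier_ge0.
suff zE : zLP I P = lp_objective I P x by rewrite zE; split => //; exists x.
apply/eqP; rewrite eq_le; apply/andP; split.
  by apply: ge_sup => //; exists (lp_objective I P x), x.
by apply: ub_le_sup; [exists (lp_objective I P x) | exists x].
Qed.

Lemma zLP_le_dual (l P : R) : 0 <= l -> 0 <= P -> zLP I P <= dual l P.
Proof.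
by move=> l0 /zLP_optimal[[x xf <-] _]; apply: weak_duality.
Qed.

Lemma zLP_dual (P : R) : 0 <= P -> exists o, zLP I P = dual (multiplier o) P.
Proof.
move=> P0; have [o [x [xf xE]]] := strong_duality P P0; exists o.
apply/eqP; rewrite eq_le zLP_le_dual ?multiplier_ge0//= -xE.
by have [_] := zLP_optimal P P0; apply; exists x.
Qed.

Lemma zLP_argmin (P : R) o : 0 <= P -> argmin R _ multiplier dual o P ->
  zLP I P = dual (multiplier o) P.
Proof.
move=> P0 oP; apply/eqP; rewrite eq_le zLP_le_dual ?multiplier_ge0//=.
by have [o' ->] := zLP_dual P P0.
Qed.

End Duality.

Theorem theorem1 (R : realType) (n : nat) (I : pkp n) :
  let M : R := (max_penalty I)%:R in
  [/\ forall P : R, 0 <= P <= M ->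
        is_max (lp_objective I P @` lp_feasible I P) (zLP I P),
      concave_on `[0, M] (zLP I : R -> R) &
      piecewise_linear_on 0 M (2 * n) (zLP I : R -> R)].
Proof.
move=> M; split.
- by move=> P /andP[P0 _]; apply: zLP_optimal.
- move=> t P Q; rewrite !inE /= !in_itv /= => /andP[P0 _] /andP[Q0 _].
  rewrite !convRE.
  have t01 : 0 <= (t%:num : R) <= 1 by rewrite ge0 le1.
  set s : R := t%:num in t01 *; rewrite /onem.
  have X0 : 0 <= s * P + (1 - s) * Q by nra.
  (* A multiplier optimal at the combination bounds [zLP] from above at [P] and [Q] too, and its
     bound is concave. *)
  have [o oE] := zLP_dual R n I _ X0.
  have := dual_concave R n I (multiplier R n I o) P Q s t01.
  have := zLP_le_dual R n I _ P (multiplier_ge0 R n I o) P0.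
  have := zLP_le_dual R n I _ Q (multiplier_ge0 R n I o) Q0.
  rewrite oE; nra.
have [M0|M0] := eqVneq (max_penalty I) 0%N.
  by exists 0%N, (fun=> 0); rewrite /M M0.
have M_gt0 : 0 < M by rewrite ltr0n lt0n.
pose th (j : 'I_n) : R :=
  threshold R _ (multiplier R n I) (dual R n I) 0 M (Some j).
(* Only the [n] options [Some j] contribute thresholds, as [None] has the least multiplier. *)
pose s := [seq th j | j <- enum 'I_n] ++ [seq (penalty I j)%:R | j <- enum 'I_n].
have -> : (2 * n)%N = size s.
  by rewrite /s size_cat !size_map -enumT size_enum_ord addnn mul2n.
apply: piecewise_linear_on_breakpoints => //.
  (* With no items the maximum would be 0; otherwise some item attains it, so [M] is among the
     penalties. *)
  case: (posnP n) => [n0|n0].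
    move: M0; rewrite /max_penalty big1 ?eqxx// => j _.
    by case: j => k kn; exfalso; move: kn; rewrite n0.
  rewrite mem_cat; apply/orP; right.
  have [|j jE] := @bigop.eq_bigmax 'I_n (fun j => penalty I j); first by rewrite card_ord.
  by rewrite /M /max_penalty jE; apply: map_f; rewrite mem_enum.
move=> x y x0 xy yM sP.
apply: (envelope_affine R _ (multiplier R n I) (dual R n I) 0 M _ None) => //.
- by move=> l m P Q lm _ PQ _; apply: dual_single_crossing.
- exact: multiplier_ge0.
- case=> // j _; apply: sP; rewrite mem_cat; apply/orP; left.
  by apply/mapP; exists j; rewrite ?mem_enum.
- move=> o; apply: dual_affine => // j; apply: sP; rewrite mem_cat.
  by apply/orP; right; apply/mapP; exists j; rewrite ?mem_enum.
- by move=> q /andP[q0 _] o; apply: zLP_argmin.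
Qed.
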